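(* Let $G$ be a countable discrete RP-group and let $\phi$ be an automorphism of $G$ with $R(\phi)<\infty$. Let $S_f(\phi)$ be the number of fixed points of the map $\widehat\phi_f:\widehat G_f\to\widehat G_f$, $\rho\mapsto\rho\circ\phi$. Then $$R(\phi)=S_f(\phi).$$
   Context: Elements $x,x'\in G$ are $\phi$-conjugate if $x'=gx\phi(g^{-1})$ for some $g\in G$; the equivalence classes are called $\phi$-conjugacy (Reidemeister) classes, and $R(\phi)$ is their number. For an automorphism $\phi$ of $G$, the characteristic function $f:G\to\{0,1\}$ of a $\phi$-conjugacy class is called periodic if there exist a finite group $K$, an automorphism $\phi_K$ of $K$ and an epimorphism $F:G\to K$ such that $F\circ\phi=\phi_K\circ F$ and $f=f_K\circ F$, where $f_K$ is the characteristic function of a subset of $K$. $G$ is an RP-group if for every automorphism $\phi$ of $G$ with $R(\phi)<\infty$ the characteristic functions of all $\phi$-conjugacy classes are periodic. $\widehat G$ denotes the unitary dual of $G$, i.e. the set of equivalence classes of irreducible unitary representations of $G$, and $\widehat G_f\subset\widehat G$ is the subset of classes of finite-dimensional representations. *)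

(* Defs.v *)
From HB Require Import structures.
From mathcomp Require Import all_boot all_order all_algebra all_fingroup.
From mathcomp Require Import sesquilinear spectral.
From mathcomp Require Import all_classical all_reals.
From mathcomp Require Export complex.

Set Implicit Arguments.
Unset Strict Implicit.
Unset Printing Implicit Defensive.

Import Order.TTheory GRing.Theory Num.Theory.

Local Open Scope classical_set_scope.
Local Open Scope ring_scope.
Local Open Scope sesquilinear_scope.

Section TwistedConjugacy.
Variable G : groupType.
Implicit Type phi : {multiplicative G -> G}.

Definition twisted_conj phi (x x' : G) : Prop :=
  exists g : G, x' = (g * x * phi (g^-1))%g.

Definition twisted_class phi (x : G) : set G := [set x' | twisted_conj phi x x'].

(* R(phi) is the cardinality of this set of classes. *)
Definition reidemeister_classes phi : set (set G) := range (twisted_class phi).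

Definition charfun (T : Type) (A : set T) : T -> bool := fun x => `[< A x >].

Definition periodic phi (f : G -> bool) : Prop :=
  exists (K : finGroupType) (phiK : {multiplicative K -> K})
         (F : {multiplicative G -> K}),
    [/\ bijective phiK,
        set_surj [set: G] [set: K] F,
        F \o phi =1 phiK \o F &
        exists A : set K, f =1 charfun A \o F].

Definition RP_group : Prop :=
  forall phi, bijective phi -> finite_set (reidemeister_classes phi) ->
    forall c, reidemeister_classes phi c -> periodic phi (charfun c).

End TwistedConjugacy.

Section UnitaryDual.
Variables (R : realType) (G : groupType).

(* A finite-dimensional Hilbert space is taken to be some C^n with its standard
   inner product; every one is isometric to such a space, so every unitary
   equivalence class of finite-dimensional representations is represented. *)
Record unitary_rep := UnitaryRep {
  rep_dim : nat;
  rep_mx :> G -> 'M[R[i]]_rep_dim;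
  rep_unitary : forall g, rep_mx g \is unitarymx;
  rep_mx1 : rep_mx 1%g = 1%:M;
  rep_mxM : forall g h, rep_mx (g * h)%g = rep_mx g *m rep_mx h
}.

(* Matrices act on column vectors, whereas the library encodes a subspace as a
   row space; hence the transposes. *)
Definition irreducible_rep (rho : unitary_rep) : Prop :=
  (0 < rep_dim rho)%N /\
  forall W : 'M[R[i]]_(rep_dim rho),
    (forall g, stablemx W (rho g)^T) -> W = 0 \/ row_full W.

(* For a rectangular U, [U \is unitarymx] only says U U^* = 1, so both
   conditions are needed to make U a unitary isomorphism. *)
Definition unitary_equiv (rho sigma : unitary_rep) : Prop :=
  exists U : 'M[R[i]]_(rep_dim sigma, rep_dim rho),
    [/\ U \is unitarymx, U^t* \is unitarymx &
        forall g, U *m rho g = sigma g *m U].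

Definition rep_class (rho : unitary_rep) : set unitary_rep :=
  [set sigma | unitary_equiv rho sigma].

Definition unitary_dual_f : set (set unitary_rep) :=
  [set rep_class rho | rho in irreducible_rep].

Section Pullback.
Variables (phi : {multiplicative G -> G}) (rho : unitary_rep).

Fact pullback_unitary g : (rho \o phi) g \is unitarymx.
Proof. exact: rep_unitary. Qed.

Fact pullback_mx1 : (rho \o phi) 1%g = 1%:M.
Proof.
have phi1 : phi 1%g = 1%g.
  by apply: (@mulgI _ (phi 1%g)); rewrite -gmulfM !mulg1.
by rewrite /= phi1 rep_mx1.
Qed.

Fact pullback_mxM g h :
  (rho \o phi) (g * h)%g = (rho \o phi) g *m (rho \o phi) h.
Proof. by rewrite /= gmulfM rep_mxM. Qed.

Definition pullback_rep : unitary_rep :=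
  UnitaryRep pullback_unitary pullback_mx1 pullback_mxM.

End Pullback.

(* For phi an automorphism this sends the class of rho to the class of
   rho \o phi. *)
Definition dual_map (phi : {multiplicative G -> G}) (c : set unitary_rep) :
    set unitary_rep :=
  \bigcup_(rho in c) rep_class (pullback_rep phi rho).

(* S_f(phi) is the cardinality of this set. *)
Definition dual_fixed_points (phi : {multiplicative G -> G}) :
    set (set unitary_rep) :=
  [set c | unitary_dual_f c /\ dual_map phi c = c].

End UnitaryDual.

Arguments dual_fixed_points R {G} phi.

(* Main.v *)
Require Import Defs.
From mathcomp Require Import all_boot all_order all_algebra all_fingroup.
From mathcomp Require Import all_classical all_reals.
From mathcomp Require Import sesquilinear spectral finmap.

(** Let S be the set of fixed points of the dual map and X the finite set of
    twisted classes.  A fixed point, represented by an irreducible [rho], comes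
    with a unitary [U] satisfying [U rho(g) = rho(phi g) U], and the twisted
    character [g |-> tr(U rho(g))] is then constant on twisted classes
    ([trace_twisted_conj]).  The theorem holds because the twisted characters of
    the elements of S form a basis of the space of complex functions on X, so
    that the table of their values is square.

    They are linearly independent because matrix coefficients of pairwise
    inequivalent finite-dimensional irreducible unitary representations are, for
    any group ([dual_coefs_independent]).  This follows from Schur's lemma
    and the double commutant theorem ([bicommutant_trace]), applied to a direct
    sum of such representations.  In particular S is finite.

    They span because of the RP property: the indicator of a twisted class
    factors through a finite quotient, hence is a coefficient of the pullback
    of its regular representation ([regular_coefficient]), and by complete
    reducibility a finite sum of terms [tr(A rho(g))] with the [rho]
    irreducible and inequivalent ([periodic_dual_span]).  Invariance of the
    indicator under twisted conjugacy and independence show that each [A]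
    intertwines [rho] with its pullback ([twisted_coefs_intertwine]).  By
    Schur's lemma, [A] is zero or else [rho] is a fixed point and [A] a multiple
    of its [U]. *)

Set Implicit Arguments.
Unset Strict Implicit.
Unset Printing Implicit Defensive.

Import Order.TTheory GRing.Theory Num.Theory.

Local Open Scope classical_set_scope.
Local Open Scope card_scope.
Local Open Scope ring_scope.
Local Open Scope sesquilinear_scope.

Lemma multiplicative_1 (G K : groupType) (f : {multiplicative G -> K}) :
  f 1%g = 1%g.
Proof. by apply: (@mulgI _ (f 1%g)); rewrite -gmulfM !mulg1. Qed.

(** * Orthogonal projectors and spans *)

Section LinearAlgebra.
Variable C : numClosedFieldType.

Lemma adjmxM m n p (A : 'M[C]_(m, n)) (B : 'M[C]_(n, p)) :
  (A *m B)^t* = B^t* *m A^t*.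
Proof. by rewrite trmx_mul map_mxM. Qed.

Lemma adjmxB m n (A B : 'M[C]_(m, n)) : (A - B)^t* = A^t* - B^t*.
Proof. by apply/matrixP=> i j; rewrite !mxE rmorphB. Qed.

Lemma adjmx1 n : (1%:M : 'M[C]_n)^t* = 1%:M.
Proof. by rewrite trmx1 map_mx1. Qed.

Lemma unitary_row_basis m n (W : 'M[C]_(m, n)) :
  exists2 Q : 'M[C]_(\rank W, n), Q \is unitarymx & (Q :=: W)%MS.
Proof.
exists (schmidt (row_base W)).
  by apply: schmidt_unitarymx; apply: rank_leq_col.
apply: eqmx_trans (eq_row_base W).
by apply: eqmx_schmidt_free; apply: row_base_free.
Qed.

(** A projector is taken Hermitian because adjoints then exchange the two sides
    of a relation: this is what turns invariance of its row space into
    commutation in [projector_commutes]. *)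
Lemma orthogonal_projector m n (W : 'M[C]_(m, n)) :
  exists P : 'M[C]_n, [/\ P^t* = P, P *m P = P & (P :=: W)%MS].
Proof.
have [Q uQ eQW] := unitary_row_basis W.
have QQ := unitarymxP uQ.
exists (Q^t* *m Q); split.
- by rewrite adjmxM trmxCK.
- by rewrite mulmxA -(mulmxA _ Q) QQ mulmx1.
- apply: eqmx_trans eQW; apply/eqmxP; rewrite submxMl /=.
  by rewrite -{1}[Q]mul1mx -QQ -mulmxA submxMl.
Qed.

Lemma idempotent_id n p (P : 'M[C]_n) (X : 'M[C]_(p, n)) :
  P *m P = P -> (X <= P)%MS -> X *m P = X.
Proof. by move=> PP /submxP[Y ->]; rewrite -mulmxA PP. Qed.

(** The isometry [Q] identifies the range of [P] with a standard C^r, which is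
    the form in which a subrepresentation has to be presented. *)
Lemma hermitian_idempotent_factor n (P : 'M[C]_n) :
  P^t* = P -> P *m P = P ->
  exists2 Q : 'M[C]_(\rank P, n), Q \is unitarymx & P = Q^t* *m Q.
Proof.
move=> hP PP.
have factor r (Q : 'M[C]_(r, n)) :
    Q \is unitarymx -> (Q :=: P)%MS -> P = Q^t* *m Q.
  move=> /unitarymxP QQ eQP.
  have QP : Q *m P = Q by apply: idempotent_id => //; rewrite eQP.
  have PQ : P *m Q^t* = Q^t* by rewrite -[in RHS]QP adjmxM hP.
  have /submxP[Y PY] : (P <= Q)%MS by rewrite eQP.
  by rewrite -PQ PY -!mulmxA (mulmxA Q) QQ mul1mx.
by have [Q uQ eQP] := unitary_row_basis P; exists Q => //; apply: factor.
Qed.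

(** Both [P T P = P T] and [P T^* P = P T^*] hold by invariance, and the
    adjoint of the second one is [P T P = T P]. *)
Lemma projector_commutes n (P T : 'M[C]_n) :
    P^t* = P -> P *m P = P ->
    (P *m T <= P)%MS -> (P *m T^t* <= P)%MS ->
  P *m T = T *m P.
Proof.
move=> hP PP sT sT'; rewrite -(idempotent_id PP sT).
have /(congr1 (fun X => X^t*)) := idempotent_id PP sT'.
by rewrite !adjmxM trmxCK hP mulmxA => <-.
Qed.

(** The span of a possibly infinite family, as a single matrix: among the spans
    of finite subfamilies, one of maximal rank contains every member.  The
    second property states by duality that this space is not larger than the
    span. *)
Lemma span_family (T : Type) n (f : T -> 'rV[C]_n) :
  exists W : 'M[C]_n, (forall t, (f t <= W)%MS) /\
    forall m (A : 'M[C]_(n, m)), (forall t, f t *m A = 0) -> W *m A = 0.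
Proof.
pose span (s : seq T) : 'M[C]_n := (\sum_(t <- s) <<f t>>)%MS.
pose P := fun k => `[< exists s, \rank (span s) = k >].
have exP : exists k, P k.
  by exists (\rank (span [::])); apply/asboolP; exists [::].
have ubP k : P k -> (k <= n)%N by move=> /asboolP[s <-]; apply: rank_leq_col.
case: (ex_maxnP exP ubP) => k /asboolP[s rs] maxk.
exists (span s); split=> [t|m A fA0].
- have sub : (span s <= span (t :: s))%MS by rewrite /span big_cons addsmxSr.
  have /geq_leqif := mxrank_leqif_sup sub.
  rewrite rs maxk; last by apply/asboolP; exists (t :: s).
  move=> /esym; apply: submx_trans.
  by rewrite /span big_cons (submx_trans _ (addsmxSl _ _)) ?genmxE.
- apply/sub_kermxP; rewrite /span; elim: s {rs} => [|t s IH].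
    by rewrite big_nil sub0mx.
  by rewrite big_cons addsmx_sub IH andbT genmxE; apply/sub_kermxP.
Qed.

Lemma mul_mx_deltaE m n p (A : 'M[C]_(m, n)) j (a : 'I_p) i k :
  (A *m delta_mx j a) i k = A i j * (k == a)%:R.
Proof.
rewrite mxE (bigD1 j) //= big1 => [|j' ne]; rewrite mxE.
  by rewrite eqxx addr0.
by rewrite (negPf ne) mulr0.
Qed.

(** Left multiplication by [A], read on flattened matrices, is the Kronecker
    product of [A^T] with an identity. *)
Lemma lin_mulmxE m n p (A : 'M[C]_(m, n)) i (j : 'I_p) k l :
  lin_mulmx A (mxvec_index i j) (mxvec_index k l) = A k i * (j == l)%:R.
Proof.
rewrite /lin_mulmx /lin_mx mxE /= mxvecE -mxvec_delta mxvecK.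
by rewrite mul_mx_deltaE eq_sym.
Qed.

Lemma lin_mulmx_adj n p (A : 'M[C]_n) :
  (lin_mulmx A : 'M[C]_(n * p))^t* = lin_mulmx (A^t*).
Proof.
apply/matrixP=> a b; case/mxvec_indexP: a => i j; case/mxvec_indexP: b => k l.
have adjE q (X : 'M[C]_q) r s : X^t* r s = (X s r)^* by rewrite !mxE.
by rewrite adjE !lin_mulmxE adjE rmorphM /= rmorph_nat eq_sym.
Qed.

(** Trace pairings of matrices become dot products of their flattenings, so a
    linear condition on a trace is a condition on a row vector. *)
Lemma mxvec_dot m n (A B : 'M[C]_(m, n)) :
  mxvec A *m (mxvec B)^T = (\tr (A *m B^T))%:M.
Proof.
apply/matrixP=> i j; rewrite !ord1 !mxE eqxx mulr1n.
rewrite (reindex _ (curry_mxvec_bij _ _)) /= /mxtrace.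
under [RHS]eq_bigr do rewrite mxE.
rewrite pair_bigA /=; apply: eq_bigr => -[k l] _ /=.
by rewrite !mxE !mxvecE.
Qed.

End LinearAlgebra.

(** * Intertwiners, Schur's lemma and unitary equivalence *)

Section Intertwiners.
Variables (R : realType) (G : groupType).
Local Notation C := (R[i]).
Local Notation rep := (unitary_rep R G).

Definition intertwiner (rho tau : rep) (Z : 'M[C]_(rep_dim tau, rep_dim rho)) :=
  forall g, Z *m rho g = tau g *m Z.

Lemma rep_mulVK (rho : rep) g p (X : 'M[C]_(rep_dim rho, p)) :
  rho g^-1%g *m (rho g *m X) = X.
Proof. by rewrite mulmxA -rep_mxM mulVg rep_mx1 mul1mx. Qed.

Lemma rep_adj (rho : rep) g : (rho g)^t* = rho g^-1%g.
Proof.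
by rewrite -[LHS](rep_mulVK g) (unitarymxP (rep_unitary rho g)) mulmx1.
Qed.

Lemma intertwiner_adj (rho tau : rep) Z :
  @intertwiner rho tau Z -> @intertwiner tau rho (Z^t*).
Proof.
move=> iZ g; have := congr1 (fun X => X^t*) (iZ g^-1%g).
by rewrite !adjmxM !rep_adj invgK => ->.
Qed.

Lemma intertwiner_comp (rho tau sigma : rep) Y Z :
  @intertwiner rho tau Y -> @intertwiner tau sigma Z ->
  @intertwiner rho sigma (Z *m Y).
Proof. by move=> iY iZ g; rewrite -mulmxA iY mulmxA iZ mulmxA. Qed.

(** The double commutant theorem in dual form: a trace functional vanishing on
    [sigma] vanishes on the whole bicommutant of [sigma].  Let [p] be the
    orthogonal projection of the matrix algebra onto the span of the
    [sigma g].  That span and, by unitarity, its orthogonal are stable under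
    left multiplication by [sigma], so [p] commutes with these multiplications.
    Seen column by column, [p] is then a matrix of intertwiners of [sigma], and
    hence commutes with left multiplication by every [M] of the bicommutant:
    [p M = M (p 1) = M], which puts [M] in the span. *)
Lemma bicommutant_trace (sigma : rep) (B M : 'M[C]_(rep_dim sigma)) :
    (forall Z, @intertwiner sigma sigma Z -> M *m Z = Z *m M) ->
    (forall g, \tr (B *m sigma g) = 0) ->
  \tr (B *m M) = 0.
Proof.
set n := rep_dim sigma in B M * => commM trB.
have [W [spanW dualW]] := span_family (fun g => mxvec (sigma g)).
have stableW g : (W *m lin_mulmx (sigma g) <= W)%MS.
  rewrite submxE -mulmxA; apply/eqP; apply: dualW => h.
  rewrite mulmxA mul_vec_lin /= -rep_mxM.
  by apply/eqP; rewrite -submxE; apply: spanW.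
have [P [hP PP eqPW]] := orthogonal_projector W.
have commP g : P *m lin_mulmx (sigma g) = lin_mulmx (sigma g) *m P.
  have stableP h : (P *m lin_mulmx (sigma h) <= P)%MS.
    by rewrite eqPW (submx_trans _ (stableW h)) // submxMr ?eqPW.
  by apply: projector_commutes => //; rewrite lin_mulmx_adj rep_adj.
pose p (X : 'M[C]_n) := vec_mx (mxvec X *m P) : 'M[C]_n.
have pE X : mxvec (p X) = mxvec X *m P by rewrite vec_mxK.
have trp X : \tr (B *m p X) = 0.
  have : mxvec (p X) *m (mxvec B^T)^T = 0.
    rewrite pE -mulmxA; have /submxP[Y ->] : (P <= W)%MS by rewrite eqPW.
    rewrite -(mulmxA Y) dualW ?mulmx0 // => g.
    by rewrite mxvec_dot trmxK mxtrace_mulC trB raddf0.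
  rewrite mxvec_dot trmxK mxtrace_mulC => /matrixP/(_ 0 0).
  by rewrite !mxE eqxx mulr1n.
have p1 : p 1%:M = 1%:M.
  by rewrite /p -(rep_mx1 sigma) idempotent_id ?mxvecK ?eqPW ?spanW.
have p_equivariant g X : p (sigma g *m X) = sigma g *m p X.
  apply: (can_inj mxvecK); rewrite pE.
  have vecM A Y : mxvec (A *m Y) = mxvec Y *m lin_mulmx A :> 'rV[C]_(n * n).
    by rewrite mul_vec_lin.
  by rewrite !vecM pE -!mulmxA commP.
(* [Z a b] sends a vector placed in column [a] to column [b] of its image. *)
pose Z a b : 'M[C]_n := \matrix_(i, j) p (delta_mx j a) i b.
have pZ X i b : p X i b = \sum_a (Z a b *m X) i a.
  rewrite {1}[X]matrix_sum_delta /p !linear_sum mulmx_suml linear_sum summxE.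
  under eq_bigr do rewrite linear_sum mulmx_suml linear_sum summxE.
  rewrite exchange_big /=; apply: eq_bigr => a _; rewrite [RHS]mxE.
  apply: eq_bigr => j _; rewrite linearZ -scalemxAl linearZ [LHS]mxE mulrC.
  by rewrite [Z a b i j]mxE.
have iZ a b : @intertwiner sigma sigma (Z a b).
  move=> g; apply/matrixP=> i j.
  transitivity (p (sigma g *m delta_mx j a) i b).
    rewrite pZ (bigD1 a) //= big1 => [|a' ne]; rewrite mulmxA mul_mx_deltaE.
      by rewrite eqxx mulr1 addr0.
    by rewrite (negPf ne) mulr0.
  rewrite p_equivariant [LHS]mxE [RHS]mxE; apply: eq_bigr => l _.
  by rewrite [Z a b l j]mxE.
suff <- : p M = M by [].
rewrite -[RHS]mulmx1 -p1; apply/matrixP=> i b; rewrite pZ mxE.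
under eq_bigr do rewrite -commM // mxE.
rewrite exchange_big /=; apply: eq_bigr => l _; rewrite pZ mulr_sumr.
by apply: eq_bigr => a _; rewrite mulmx1.
Qed.

(** The kernel of [Z] is an invariant subspace; in the row-space encoding it is
    the kernel of [Z^T]. *)
Lemma irreducible_kernel (rho tau : rep) Z :
  irreducible_rep rho -> @intertwiner rho tau Z -> Z = 0 \/ row_free Z^T.
Proof.
move=> [_ irr] iZ; have [g||fullK] := irr (kermx Z^T).
- apply/sub_kermxP.
  by rewrite -mulmxA -trmx_mul iZ trmx_mul mulmxA mulmx_ker mul0mx.
- by move=> /eqP; rewrite kermx_eq0; right.
- left; apply: trmx_inj; rewrite trmx0 -[LHS]mul1mx.
  by apply/sub_kermxP; rewrite sub1mx.
Qed.

Lemma schur_scalar (rho : rep) Z :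
  irreducible_rep rho -> @intertwiner rho rho Z -> exists a, Z = a%:M.
Proof.
move=> irr iZ; have [a eva] := eigenvalue_closed Z^T irr.1; exists a.
have iZa : @intertwiner rho rho (Z - a%:M).
  by move=> g; rewrite mulmxBl mulmxBr iZ scalar_mxC.
have [/eqP|] := irreducible_kernel irr iZa; first by rewrite subr_eq0 => /eqP.
rewrite -kermx_eq0 linearB /= tr_scalar_mx => /eqP ker0.
by move: eva; rewrite /eigenvalue /eigenspace ker0 eqxx.
Qed.

(** By Schur, [Z^* Z] and [Z Z^*] are scalars; they are the same positive
    number [a], so [Z / sqrt a] is unitary. *)
Lemma schur_equiv (rho tau : rep) Z :
    irreducible_rep rho -> irreducible_rep tau -> @intertwiner rho tau Z ->
  Z != 0 -> unitary_equiv rho tau.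
Proof.
move=> irr irt iZ Z0; have iZ' := intertwiner_adj iZ.
have [a aE] := schur_scalar irr (intertwiner_comp iZ iZ').
have [b bE] := schur_scalar irt (intertwiner_comp iZ' iZ).
have ab : a = b.
  have : a *: Z = b *: Z.
    by rewrite -[RHS]mul_scalar_mx -bE -mulmxA aE mul_mx_scalar.
  move/eqP; rewrite -subr_eq0 -scalerBl scaler_eq0 (negPf Z0) orbF subr_eq0.
  by move/eqP.
have a_gt0 : 0 < a.
  have [i [j Zij]] : exists i j, Z i j != 0.
    apply: contrapT => nZ; case/eqP: Z0; apply/matrixP => i j; rewrite mxE.
    by apply/eqP; apply: contrapT => /negP Zij; apply: nZ; exists i, j.
  have -> : a = \sum_k `|Z k j| ^+ 2.
    have /matrixP/(_ j j) := aE; rewrite !mxE eqxx mulr1n => <-.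
    by apply: eq_bigr => k _; rewrite !mxE mulrC normCK.
  rewrite (bigD1 i) //= ltr_wpDr ?sumr_ge0 // => [k _|].
    exact: exprn_ge0.
  by rewrite exprn_gt0 ?normr_gt0.
have s_real : (sqrtC a)^-1^* = (sqrtC a)^-1.
  by rewrite conj_Creal // ger0_real // invr_ge0 sqrtC_ge0 ltW.
have sK : (sqrtC a)^-1 * (sqrtC a)^-1 * a = 1.
  by rewrite -{3}(sqrtCK a) expr2 mulrACA mulVf ?mulr1 // sqrtC_eq0 gt_eqF.
have adjU : ((sqrtC a)^-1 *: Z)^t* = (sqrtC a)^-1 *: Z^t*.
  by rewrite linearZ /= map_mxZ; congr (_ *: _); apply: s_real.
exists ((sqrtC a)^-1 *: Z); split=> [||g].
- apply/unitarymxP; rewrite adjU -scalemxAl -scalemxAr scalerA bE -ab.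
  by rewrite scale_scalar_mx sK.
- apply/unitarymxP; rewrite trmxCK adjU -scalemxAl -scalemxAr scalerA aE.
  by rewrite scale_scalar_mx sK.
- by rewrite -scalemxAl iZ -scalemxAr.
Qed.

Lemma unitary_equiv_refl (rho : rep) : unitary_equiv rho rho.
Proof.
exists 1%:M; split=> [||g]; last by rewrite mul1mx mulmx1.
- by apply/unitarymxP; rewrite adjmx1 mulmx1.
- by apply/unitarymxP; rewrite trmxCK adjmx1 mulmx1.
Qed.

Lemma unitary_equiv_sym (rho tau : rep) :
  unitary_equiv rho tau -> unitary_equiv tau rho.
Proof.
move=> [U [uU uU' iU]]; exists (U^t*); split; rewrite ?trmxCK //.
exact: intertwiner_adj.
Qed.

Lemma unitary_equiv_trans (rho tau sigma : rep) :
  unitary_equiv rho tau -> unitary_equiv tau sigma -> unitary_equiv rho sigma.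
Proof.
move=> [U [uU uU' iU]] [V [uV uV' iV]]; exists (V *m U); split.
- exact: mul_unitarymx.
- by rewrite adjmxM mul_unitarymx.
- exact: intertwiner_comp iU iV.
Qed.

Lemma rep_class_eqP (rho tau : rep) :
  rep_class rho = rep_class tau <-> unitary_equiv rho tau.
Proof.
split=> [e|e].
  suff : rep_class rho tau by [].
  by rewrite e; apply: unitary_equiv_refl.
apply/seteqP; split=> sigma /=.
  by apply: unitary_equiv_trans; apply: unitary_equiv_sym.
exact: unitary_equiv_trans.
Qed.

Lemma dual_map_class (phi : {multiplicative G -> G}) (rho : rep) :
  dual_map phi (rep_class rho) = rep_class (pullback_rep phi rho).
Proof.
apply/seteqP; split=> [sigma [tau [U [uU uU' iU]]]|sigma e].
  apply: unitary_equiv_trans; exists U; split=> // g; exact: iU.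
by exists rho => //; apply: unitary_equiv_refl.
Qed.

Lemma irreducible_pullback (phi : {multiplicative G -> G}) (rho : rep) :
  bijective phi -> irreducible_rep rho ->
  irreducible_rep (pullback_rep phi rho).
Proof.
move=> [psi _ psiK] [d0 irr]; split=> // W stW; apply: irr => g.
by rewrite -(psiK g); apply: stW.
Qed.

Program Definition zero_rep : rep :=
  @UnitaryRep R G 0 (fun _ => 0) _ _ _.
Next Obligation.
by move=> g; apply/unitarymxP; rewrite [LHS]flatmx0 [RHS]flatmx0.
Qed.
Next Obligation. by rewrite [RHS]flatmx0. Qed.
Next Obligation. by move=> g h; rewrite mul0mx. Qed.

(** Stated for all [c] so that a representative can be chosen by a total
    function; [zero_rep] is the default value. *)
Lemma dual_rep_exists (c : set rep) :
  exists rho : rep,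
    unitary_dual_f c -> irreducible_rep rho /\ rep_class rho = c.
Proof.
have [[rho irr rc]|nc] := pselect (unitary_dual_f c); first by exists rho.
by exists zero_rep.
Qed.

Definition dual_rep (c : set rep) : rep := projT1 (cid (dual_rep_exists c)).

Lemma dual_repP c :
  unitary_dual_f c ->
  irreducible_rep (dual_rep c) /\ rep_class (dual_rep c) = c.
Proof. by rewrite /dual_rep; case: cid. Qed.

Lemma dual_rep_disjoint c d Z :
    unitary_dual_f c -> unitary_dual_f d -> c <> d ->
  @intertwiner (dual_rep c) (dual_rep d) Z -> Z = 0.
Proof.
move=> /dual_repP[irc cE] /dual_repP[ird dE] cd iZ; apply/eqP/negPn/negP => Z0.
by apply: cd; rewrite -cE -dE; apply/rep_class_eqP; apply: schur_equiv iZ Z0.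
Qed.

(** * Independence of the coefficients of inequivalent irreducibles *)

Section DirectSum.
Variables rho tau : rep.

Definition direct_sum_mx g := block_mx (rho g) 0 0 (tau g).

Fact direct_sum_unitary g : direct_sum_mx g \is unitarymx.
Proof.
apply/unitarymxP; rewrite tr_block_mx map_block_mx !trmx0 !map_mx0 mulmx_block.
rewrite !(unitarymxP (rep_unitary _ _)) !mulmx0 !mul0mx !addr0 !add0r.
by rewrite -scalar_mx_block.
Qed.

Fact direct_sum_mx1 : direct_sum_mx 1%g = 1%:M.
Proof. by rewrite /direct_sum_mx !rep_mx1 -scalar_mx_block. Qed.

Fact direct_sum_mxM g h :
  direct_sum_mx (g * h)%g = direct_sum_mx g *m direct_sum_mx h.
Proof.
by rewrite /direct_sum_mx mulmx_block !rep_mxM !mulmx0 !mul0mx !addr0 !add0r.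
Qed.

Definition direct_sum : rep :=
  UnitaryRep direct_sum_unitary direct_sum_mx1 direct_sum_mxM.

End DirectSum.

Lemma trace_direct_sum (rho tau : rep) A B g :
  \tr (block_mx A 0 0 B *m direct_sum rho tau g) =
  \tr (A *m rho g) + \tr (B *m tau g).
Proof.
by rewrite mulmx_block mxtrace_block !mul0mx addr0 add0r.
Qed.

(** By Schur, the commutant of the direct sum of [rho] and [tau] consists of
    block diagonal matrices with a scalar first block, so every
    [block_mx X 0 0 0] lies in the bicommutant.  Hence [A] is orthogonal to all
    matrices [X]. With [tau] zero this is Burnside's theorem. *)
Lemma disjoint_coef_eq0 (rho tau : rep) A B :
    irreducible_rep rho -> (forall Z, @intertwiner rho tau Z -> Z = 0) ->
    (forall g, \tr (A *m rho g) + \tr (B *m tau g) = 0) ->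
  A = 0.
Proof.
move=> irr disj trAB.
have trA X : \tr (A *m X) = 0.
  have <- : \tr (block_mx A 0 0 B *m block_mx X 0 0 0) = \tr (A *m X).
    by rewrite mulmx_block mxtrace_block !mul0mx !mulmx0 !addr0 mxtrace0 addr0.
  apply: (@bicommutant_trace (direct_sum rho tau)) => [Z|g]; last first.
    by rewrite trace_direct_sum.
  rewrite -[Z]submxK; move: (ulsubmx Z) (ursubmx Z) (dlsubmx Z) (drsubmx Z).
  move=> Z1 Z2 Z3 Z4 iZ.
  have blocks g : [/\ Z1 *m rho g = rho g *m Z1, Z2 *m tau g = rho g *m Z2
                    & Z3 *m rho g = tau g *m Z3].
    have := iZ g; rewrite /= /direct_sum_mx !mulmx_block.
    rewrite !mul0mx !mulmx0 !addr0 !add0r.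
    by move=> /eq_block_mx[].
  have Z30 : Z3 = 0 by apply: disj => g; case: (blocks g).
  have Z20 : Z2 = 0.
    have : Z2^t* = 0.
      apply: disj; apply: (@intertwiner_adj tau rho) => g.
      by case: (blocks g).
    by move=> /(congr1 (fun X => X^t*)); rewrite trmxCK trmx0 map_mx0.
  have [a ->] : exists a, Z1 = a%:M.
    by apply: schur_scalar irr _ => g; case: (blocks g).
  rewrite Z20 Z30 !mulmx_block !mul0mx !mulmx0 !addr0 ?add0r.
  by rewrite scalar_mxC.
apply/matrixP=> i j; rewrite mxE -(trA (delta_mx j i)) /mxtrace (bigD1 i) //=.
rewrite mul_mx_deltaE eqxx mulr1 big1 ?addr0 // => k ne.
by rewrite mul_mx_deltaE (negPf ne) mulr0.
Qed.

Fixpoint dual_sum (s : seq (set rep)) : rep :=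
  if s is c :: s' then direct_sum (dual_rep c) (dual_sum s') else zero_rep.

(** One matrix for every class, although only finitely many are used at a time:
    being total, such families can be rescaled and added without reindexing. *)
Definition dual_coefs := forall c : set rep, 'M[C]_(rep_dim (dual_rep c)).

Fixpoint dual_sum_coef (A : dual_coefs) (s : seq (set rep)) :
    'M[C]_(rep_dim (dual_sum s)) :=
  if s is c :: s' then block_mx (A c) 0 0 (dual_sum_coef A s') else 0.

Lemma trace_dual_sum A s g :
  \tr (dual_sum_coef A s *m dual_sum s g) =
  \sum_(c <- s) \tr (A c *m dual_rep c g).
Proof.
elim: s => [|c s IH]; first by rewrite big_nil mul0mx mxtrace0.
by rewrite big_cons -IH -trace_direct_sum.
Qed.

Lemma dual_sum_disjoint (rho : rep) s Z :
    (forall c, c \in s -> forall Z, @intertwiner rho (dual_rep c) Z -> Z = 0) ->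
  @intertwiner rho (dual_sum s) Z -> Z = 0.
Proof.
elim: s Z => [|c s IH] Z disj.
  by move=> _; rewrite [LHS]flatmx0 [RHS]flatmx0.
rewrite -[Z](@vsubmxK _ (rep_dim (dual_rep c)) (rep_dim (dual_sum s))).
move: (usubmx _) (dsubmx _) => Z1 Z2 iZ.
have blocks g : Z1 *m rho g = dual_rep c g *m Z1 /\
                Z2 *m rho g = dual_sum s g *m Z2.
  have := iZ g; rewrite /= /direct_sum_mx mul_col_mx mul_block_col.
  by rewrite !mul0mx addr0 add0r => /eq_col_mx[].
rewrite (disj c _ Z1) ?mem_head // => [|g]; last by case: (blocks g).
rewrite (IH Z2) ?col_mx0 // => [d ds|g]; last by case: (blocks g).
by apply: disj; rewrite inE ds orbT.
Qed.

(** The theorem of Frobenius and Schur.  The head of the list is disjoint from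
    the direct sum of the tail, so its coefficient vanishes, and one goes on
    with the tail. *)
Lemma dual_coefs_independent (s : seq (set rep)) (A : dual_coefs) :
    uniq s -> (forall c, c \in s -> unitary_dual_f c) ->
    (forall g, \sum_(c <- s) \tr (A c *m dual_rep c g) = 0) ->
  forall c, c \in s -> A c = 0.
Proof.
elim: s => [|c s IH] //= /andP[cs us] dual_s sumA.
have dual_c : unitary_dual_f c by apply: dual_s; rewrite mem_head.
have dual_s' d : d \in s -> unitary_dual_f d.
  by move=> ds; apply: dual_s; rewrite inE ds orbT.
have Ac0 : A c = 0.
  apply: (@disjoint_coef_eq0 _ (dual_sum s) _ (dual_sum_coef A s)).
  - exact: (dual_repP dual_c).1.
  - move=> Z; apply: dual_sum_disjoint => d ds Y.
    apply: dual_rep_disjoint => //.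
      exact: dual_s'.
    by move=> cd; move: cs; rewrite cd ds.
  - by move=> g; rewrite trace_dual_sum; have := sumA g; rewrite big_cons.
move=> d; rewrite inE => /predU1P[-> //|]; apply: IH => // g.
by have := sumA g; rewrite big_cons Ac0 mul0mx mxtrace0 add0r.
Qed.

(** * Periodic functions are sums of irreducible coefficients *)

Definition dual_span (f : G -> C) : Prop :=
  exists s : seq (set rep), exists A : dual_coefs,
    [/\ uniq s, forall c, c \in s -> unitary_dual_f c &
        forall g, f g = \sum_(c <- s) \tr (A c *m dual_rep c g)].

Lemma sum_indicator_sub (s t : seq (set rep)) (F : set rep -> C) :
    uniq s -> uniq t -> {subset t <= s} ->
  \sum_(c <- s) (if c \in t then F c else 0) = \sum_(c <- t) F c.
Proof.
move=> us ut ts; rewrite -big_mkcond -big_filter; apply: perm_big.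
apply: uniq_perm; rewrite ?filter_uniq // => c; rewrite mem_filter.
by case ct : (c \in t) => //=; apply: ts.
Qed.

Lemma dual_span_add f1 f2 :
  dual_span f1 -> dual_span f2 -> dual_span (fun g => f1 g + f2 g).
Proof.
move=> [s1 [A1 [us1 ds1 f1E]]] [s2 [A2 [us2 ds2 f2E]]].
exists (undup (s1 ++ s2)).
exists (fun c =>
  (if c \in s1 then A1 c else 0) + (if c \in s2 then A2 c else 0)).
split=> [|c|g]; first exact: undup_uniq.
  by rewrite mem_undup mem_cat => /orP[/ds1|/ds2].
under eq_bigr do rewrite mulmxDl mxtraceD.
rewrite big_split f1E f2E /=; congr (_ + _).
  rewrite -[LHS](@sum_indicator_sub (undup (s1 ++ s2))) ?undup_uniq //.
    by apply: eq_bigr => c _; case: ifP => //; rewrite mul0mx mxtrace0.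
  by move=> c cs; rewrite mem_undup mem_cat cs.
rewrite -[LHS](@sum_indicator_sub (undup (s1 ++ s2))) ?undup_uniq //.
  by apply: eq_bigr => c _; case: ifP => //; rewrite mul0mx mxtrace0.
by move=> c cs; rewrite mem_undup mem_cat cs orbT.
Qed.

(** The range of the projector [Q^* Q], transported to C^r by [Q]. *)
Section Subrepresentation.
Variables (rho : rep) (r : nat) (Q : 'M[C]_(r, rep_dim rho)).
Hypothesis Q_unitary : Q \is unitarymx.
Hypothesis Q_comm : forall g, Q^t* *m Q *m rho g = rho g *m (Q^t* *m Q).

Definition subrep_mx g := Q *m rho g *m Q^t*.

Fact subrep_mx1 : subrep_mx 1%g = 1%:M.
Proof. by rewrite /subrep_mx rep_mx1 mulmx1 (unitarymxP Q_unitary). Qed.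

Fact subrep_mxM g h : subrep_mx (g * h)%g = subrep_mx g *m subrep_mx h.
Proof.
rewrite /subrep_mx rep_mxM -!mulmxA (mulmxA (Q^t*) Q) (mulmxA (Q^t* *m Q)).
by rewrite Q_comm -!mulmxA (unitarymxP Q_unitary) mulmx1.
Qed.

Fact subrep_unitary g : subrep_mx g \is unitarymx.
Proof.
apply/unitarymxP.
have -> : (subrep_mx g)^t* = subrep_mx g^-1%g.
  by rewrite /subrep_mx !adjmxM trmxCK rep_adj mulmxA.
by rewrite -subrep_mxM mulgV subrep_mx1.
Qed.

Definition subrep : rep := UnitaryRep subrep_unitary subrep_mx1 subrep_mxM.

Lemma trace_subrep B g :
  \tr (Q *m B *m Q^t* *m subrep g) = \tr (B *m (Q^t* *m Q) *m rho g).
Proof.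
transitivity (\tr (B *m (Q^t* *m Q *m (rho g *m (Q^t* *m Q))))).
  by rewrite /= /subrep_mx -!mulmxA mxtrace_mulC -!mulmxA.
rewrite -Q_comm !mulmxA -(mulmxA (B *m Q^t*) Q) (unitarymxP Q_unitary).
by rewrite mulmx1.
Qed.

End Subrepresentation.

Lemma trace_irreducible_dual_span (rho : rep) B :
  irreducible_rep rho -> dual_span (fun g => \tr (B *m rho g)).
Proof.
move=> irr; have dc : unitary_dual_f (rep_class rho) by exists rho.
have [_ /rep_class_eqP/unitary_equiv_sym[U [_ /unitarymxP]]] := dual_repP dc.
rewrite trmxCK => UU iU.
exists [:: rep_class rho].
exists (@eqtype.dfwith _ (fun c => 'M[C]_(rep_dim (dual_rep c))) (fun=> 0)
  (rep_class rho) (U *m B *m U^t*)); split=> // [c|g].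
  by rewrite inE => /eqP->.
rewrite big_seq1.
transitivity (\tr (U *m B *m U^t* *m dual_rep (rep_class rho) g)); last first.
  by rewrite eqtype.dfwith_in.
rewrite -!mulmxA [RHS]mxtrace_mulC -!mulmxA -iU.
by rewrite (mulmxA (U^t*) U) UU mul1mx.
Qed.

(** Complete reducibility: if [rho] is reducible, an invariant subspace gives a
    nontrivial Hermitian projector [P] commuting with [rho], and the
    coefficient splits into those of the ranges of [P] and [1 - P], of smaller
    dimension. *)
Lemma trace_dual_span (rho : rep) B : dual_span (fun g => \tr (B *m rho g)).
Proof.
move: {2}(rep_dim rho).+1 (ltnSn (rep_dim rho)) => n.
elim: n rho B => // n IH rho B; rewrite ltnS => le_n.
have [irr|red] := pselect (irreducible_rep rho).
  exact: trace_irreducible_dual_span.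
have [d0|d0] := posnP (rep_dim rho).
  exists [::], (fun=> 0); split=> // g; rewrite big_nil /mxtrace.
  by rewrite big1 // => i _; have := ltn_ord i; rewrite {2}d0.
have [W stW [W0 Wfull]] : exists2 W : 'M_(rep_dim rho),
    (forall g, (W *m (rho g)^T <= W)%MS) & W <> 0 /\ ~ row_full W.
  apply: contrapT => noW; apply: red; split=> // W stW.
  have [->|W0] := eqVneq W 0; [by left | right].
  apply: contrapT => Wfull; apply: noW; exists W => //; split=> //.
  exact/eqP.
have [P0 [hP0 PP0 eqP0]] := orthogonal_projector W.
(* Invariant subspaces are row spaces for the transposes of the [rho g]. *)
pose P := P0^T.
have hP : P^t* = P by rewrite /P trmxK -[in RHS]hP0 map_trmx trmxK.
have PP : P *m P = P by rewrite /P -trmx_mul PP0.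
have commP g : P *m rho g = rho g *m P.
  apply: trmx_inj; rewrite !trmx_mul trmxK; apply/esym.
  have stP h : (P0 *m (rho h)^T <= P0)%MS.
    by rewrite eqP0 (submx_trans _ (stW h)) // submxMr ?eqP0.
  apply: projector_commutes => //.
  have -> : ((rho g)^T)^t* = (rho g^-1%g)^T by rewrite -rep_adj map_trmx.
  exact: stP.
have part P' : P'^t* = P' -> P' *m P' = P' ->
    (forall g, P' *m rho g = rho g *m P') -> (\rank P' < rep_dim rho)%N ->
  dual_span (fun g => \tr (B *m P' *m rho g)).
  move=> hP' PP' commP' rP'.
  have [Q uQ P'E] := hermitian_idempotent_factor hP' PP'.
  have Qcomm g : Q^t* *m Q *m rho g = rho g *m (Q^t* *m Q) by rewrite -P'E.
  have [s [A [us ds fE]]] :=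
    IH (subrep uQ Qcomm) (Q *m B *m Q^t*) (leq_trans rP' le_n).
  by exists s, A; split=> // g; rewrite -fE trace_subrep -P'E.
have rank_lt (P' : 'M[C]_(rep_dim rho)) :
    P' *m P' = P' -> P' <> 1%:M -> (\rank P' < rep_dim rho)%N.
  move=> PP' P'1; rewrite ltn_neqAle rank_leq_row andbT; apply/eqP => full.
  apply: P'1; have uP : P' \in unitmx by rewrite -row_free_unit /row_free full.
  by rewrite -[LHS](mulKmx uP) PP' mulVmx.
have P1 : P <> 1%:M.
  move=> /(congr1 trmx); rewrite trmxK trmx1 => P01.
  by apply: Wfull; rewrite -sub1mx -P01 eqP0.
have hP' : (1%:M - P)^t* = 1%:M - P by rewrite adjmxB adjmx1 hP.
have PP' : (1%:M - P) *m (1%:M - P) = 1%:M - P.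
  by rewrite mulmxBr mulmx1 mulmxBl mul1mx PP subrr subr0.
have commP' g : (1%:M - P) *m rho g = rho g *m (1%:M - P).
  by rewrite mulmxBl mulmxBr commP mulmx1 mul1mx.
have P'1 : 1%:M - P <> 1%:M.
  move/eqP; rewrite subr_eq addrC -subr_eq subrr eq_sym => /eqP.
  move=> /(congr1 trmx); rewrite trmxK trmx0 => P00.
  by apply: W0; apply/eqP; rewrite -submx0 -P00 eqP0.
have [s [A [us ds fE]]] := dual_span_add (part P hP PP commP (rank_lt _ PP P1))
  (part _ hP' PP' commP' (rank_lt _ PP' P'1)).
exists s, A; split=> // g; rewrite -fE -mxtraceD -mulmxDl -mulmxDr.
by rewrite addrC subrK mulmx1.
Qed.

(** The left regular representation of [K], pulled back along [F]: any function
    on [K] is one of its coefficients, since [a y] is the pairing of [a] with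
    the translate by [y] of the mass at 1. *)
Section RegularPullback.
Variables (K : finGroupType) (F : {multiplicative G -> K}).

Definition regular_mx g : 'M[C]_#|K| :=
  \matrix_(i, j) (enum_val i == F g * enum_val j)%g%:R.

Lemma sum_enum_eq (y : K) (a : K -> C) :
  \sum_(k < #|K|) a (enum_val k) * (enum_val k == y)%:R = a y.
Proof.
rewrite (bigD1 (enum_rank y)) //= enum_rankK eqxx mulr1 big1 ?addr0 // => k ne.
by rewrite (can2_eq (@enum_valK _) (@enum_rankK _)) (negPf ne) mulr0.
Qed.

Fact regular_mx1 : regular_mx 1%g = 1%:M.
Proof.
apply/matrixP=> i j; rewrite !mxE multiplicative_1 mul1g.
by rewrite (inj_eq enum_val_inj).
Qed.

Fact regular_mxM g h : regular_mx (g * h)%g = regular_mx g *m regular_mx h.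
Proof.
apply/matrixP=> i j; rewrite !mxE; under eq_bigr do rewrite !mxE.
rewrite (sum_enum_eq _ (fun y => (enum_val i == F g * y)%g%:R)).
by rewrite gmulfM mulgA.
Qed.

Fact regular_unitary g : regular_mx g \is unitarymx.
Proof.
apply/unitarymxP.
have -> : (regular_mx g)^t* = regular_mx g^-1%g.
  apply/matrixP=> i j; rewrite !mxE rmorph_nat; congr ((_ : bool)%:R).
  rewrite -[RHS](inj_eq (mulgI (F g))) mulgA -gmulfM mulgV.
  by rewrite multiplicative_1 mul1g eq_sym.
by rewrite -regular_mxM mulgV regular_mx1.
Qed.

Definition regular_rep : rep :=
  UnitaryRep regular_unitary regular_mx1 regular_mxM.

Lemma regular_coefficient (a : K -> C) :
  exists B, forall g, a (F g) = \tr (B *m regular_rep g).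
Proof.
exists (\matrix_(i, j) (a (enum_val j) * (enum_val i == 1%g)%:R)) => g.
rewrite -[LHS]sum_enum_eq /mxtrace /=; under [RHS]eq_bigr do rewrite mxE.
rewrite exchange_big /=; apply: eq_bigr => k _.
rewrite -[F g]mulg1.
rewrite -(sum_enum_eq 1%g
  (fun y => a (enum_val k) * (enum_val k == F g * y)%g%:R)).
by apply: eq_bigr => i _; rewrite !mxE mulrAC.
Qed.

End RegularPullback.

Lemma periodic_dual_span (phi : {multiplicative G -> G}) (f : G -> bool) :
  periodic phi f -> dual_span (fun g => (f g)%:R).
Proof.
move=> [K [phiK [F [_ _ _ [A fE]]]]].
have [B BE] := regular_coefficient F (fun k => (charfun A k)%:R).
have [s [c [us ds cE]]] := trace_dual_span B.
by exists s, c; split=> // g; rewrite fE -cE -BE.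
Qed.

End Intertwiners.

(** * Twisted conjugacy classes and twisted characters *)

Section TwistedClasses.
Variables (G : groupType) (phi : {multiplicative G -> G}).

Lemma twisted_conj_refl x : twisted_conj phi x x.
Proof. by exists 1%g; rewrite invg1 multiplicative_1 mul1g mulg1. Qed.

Lemma twisted_conj_sym x y : twisted_conj phi x y -> twisted_conj phi y x.
Proof.
move=> [g ->]; exists g^-1%g; rewrite invgK.
by rewrite !mulgA mulVg mul1g -mulgA -gmulfM mulVg multiplicative_1 mulg1.
Qed.

Lemma twisted_conj_trans x y z :
  twisted_conj phi x y -> twisted_conj phi y z -> twisted_conj phi x z.
Proof.
move=> [g ->] [h ->]; exists (h * g)%g.
by rewrite invMg gmulfM !mulgA.
Qed.

Lemma twisted_class_eqP x y :
  twisted_class phi x = twisted_class phi y <-> twisted_conj phi x y.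
Proof.
split=> [e|xy].
  suff : twisted_class phi x y by [].
  by rewrite e; apply: twisted_conj_refl.
apply/seteqP; split=> z /=.
  by apply: twisted_conj_trans; apply: twisted_conj_sym.
exact: twisted_conj_trans.
Qed.

End TwistedClasses.

Section FixedPoints.
Variables (R : realType) (G : groupType) (phi : {multiplicative G -> G}).
Hypothesis phi_bij : bijective phi.
Local Notation C := (R[i]).
Local Notation rep := (unitary_rep R G).
Local Notation twist := (pullback_rep phi).
Local Notation twisted_intertwiner c :=
  (@intertwiner R G (dual_rep c) (twist (dual_rep c))).

(** By cyclicity of the trace, the two factors of a twisted conjugation cancel
    against each other across [Z].  Thus a fixed point of the dual map gives a
    function on the set of twisted classes. *)
Lemma trace_twisted_conj (rho : rep) Z x y :
    @intertwiner R G rho (twist rho) Z -> twisted_conj phi x y ->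
  \tr (Z *m rho x) = \tr (Z *m rho y).
Proof.
move=> iZ [g ->]; have iZg := iZ g^-1%g.
rewrite !rep_mxM mulmxA [RHS]mxtrace_mulC !mulmxA.
rewrite -[rho (phi _)]/(twist rho _) -iZg -(mulmxA Z) -rep_mxM mulVg.
by rewrite rep_mx1 mulmx1.
Qed.

(** Conversely, replacing [x] by [g x phi(g^-1)] replaces each coefficient [A c]
    by another one, for the same representation, so by independence invariance
    of the sum forces invariance of each [A c]. *)
Lemma twisted_coefs_intertwine (s : seq (set rep)) (A : dual_coefs R G) :
    uniq s -> (forall c, c \in s -> unitary_dual_f c) ->
    (forall x y, twisted_conj phi x y ->
       \sum_(c <- s) \tr (A c *m dual_rep c x) =
       \sum_(c <- s) \tr (A c *m dual_rep c y)) ->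
  forall c, c \in s -> twisted_intertwiner c (A c).
Proof.
move=> us ds tw c cs g.
pose B : dual_coefs R G := fun d =>
  twist (dual_rep d) g^-1%g *m A d *m dual_rep d g - A d.
have /eqP : B c = 0.
  apply: (dual_coefs_independent us ds) cs => x.
  have /esym/eqP := tw x (g * x * phi g^-1)%g (ex_intro _ g erefl).
  rewrite -subr_eq0 -sumrB => /eqP tw0; rewrite -[RHS]tw0.
  apply: eq_bigr => d _.
  rewrite mulmxBl raddfB /=; congr (_ - _).
  by rewrite -!mulmxA mxtrace_mulC !rep_mxM -!mulmxA.
rewrite subr_eq0 => /eqP e.
by rewrite -[in RHS]e -mulmxA -[LHS](rep_mulVK (rho := twist _) g^-1%g) invgK.
Qed.

Lemma dual_fixed_intertwiner c : dual_fixed_points R phi c ->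
  exists U : 'M[C]_(rep_dim (dual_rep c)),
    [/\ U \is unitarymx, U^t* \is unitarymx &
        twisted_intertwiner c U].
Proof.
move=> [/dual_repP[_ cE]]; rewrite -{1 2}cE dual_map_class => /esym.
by move=> /rep_class_eqP[U []]; exists U.
Qed.

Lemma intertwiner_dual_fixed c Z :
    unitary_dual_f c -> twisted_intertwiner c Z -> Z != 0 ->
  dual_fixed_points R phi c.
Proof.
move=> dc iZ Z0; split=> //; have [irr cE] := dual_repP dc.
rewrite -[in RHS]cE -[in LHS]cE dual_map_class; apply/esym/rep_class_eqP.
by apply: schur_equiv iZ Z0 => //; apply: irreducible_pullback.
Qed.

Lemma dual_intertwiner_exists c : exists U : 'M[C]_(rep_dim (dual_rep c)),
  dual_fixed_points R phi c ->
    [/\ U \is unitarymx, U^t* \is unitarymx &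
        twisted_intertwiner c U].
Proof.
have [/dual_fixed_intertwiner[U UP]|nc] := pselect (dual_fixed_points R phi c).
  by exists U.
by exists 0.
Qed.

(** For a fixed point [c], a unitary intertwiner from the representative of [c]
    to its pullback; it is unique up to a scalar. *)
Definition dual_intertwiner : dual_coefs R G :=
  fun c => projT1 (cid (dual_intertwiner_exists c)).

Lemma dual_intertwinerP c : dual_fixed_points R phi c ->
  [/\ dual_intertwiner c \is unitarymx, (dual_intertwiner c)^t* \is unitarymx &
      twisted_intertwiner c (dual_intertwiner c)].
Proof. by rewrite /dual_intertwiner; case: cid. Qed.

Definition twisted_character (c : set rep) (g : G) : C :=
  \tr (dual_intertwiner c *m dual_rep c g).

Lemma dual_intertwiner_neq0 c :
  dual_fixed_points R phi c -> dual_intertwiner c != 0.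
Proof.
move=> fc; have [/unitarymxP uU _ _] := dual_intertwinerP fc.
have [[d0 _] _] := dual_repP fc.1.
apply/negP => /eqP U0; move: uU; rewrite U0 mul0mx.
move=> /matrixP/(_ (Ordinal d0) (Ordinal d0))/eqP.
by rewrite !mxE eqxx eq_sym oner_eq0.
Qed.

Lemma twisted_intertwiner_scalar c Z : dual_fixed_points R phi c ->
    twisted_intertwiner c Z ->
  exists a, Z = a *: dual_intertwiner c.
Proof.
move=> fc iZ; have [/unitarymxP uU _ iU] := dual_intertwinerP fc.
have [irr _] := dual_repP fc.1.
have [a aE] := schur_scalar irr (intertwiner_comp iZ (intertwiner_adj iU)).
by exists a; rewrite -mul_mx_scalar -aE mulmxA uU mul1mx.
Qed.

(** Here [x] is a list of elements that meets every twisted class: a function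
    constant on twisted classes is determined by its values on [x]. *)
Section Representatives.
Variables (n : nat) (x : 'I_n -> G).
Hypothesis x_cover : forall y, exists i, twisted_conj phi (x i) y.

Definition twisted_character_table (s : seq (set rep)) : 'M[C]_(size s, n) :=
  \matrix_(j, i) twisted_character (nth set0 s j) (x i).

(** A linear relation between rows holds on all of the group, by twisted
    invariance, and is then a relation between coefficients of inequivalent
    irreducibles. *)
Lemma twisted_character_table_free s :
    uniq s -> (forall c, c \in s -> dual_fixed_points R phi c) ->
  row_free (twisted_character_table s).
Proof.
move=> us fs; apply: inj_row_free => u /matrixP uV.
pose A : dual_coefs R G := fun c =>
  (\sum_(j < size s | nth set0 s j == c) u 0 j) *: dual_intertwiner c.
have AE (j : 'I_(size s)) : A (nth set0 s j) = u 0 j *: dual_intertwiner _.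
  rewrite /A (eq_bigl (pred1 j)) ?big_pred1_eq // => k.
  by rewrite nth_uniq.
have sumA y : \sum_(c <- s) \tr (A c *m dual_rep c y) = 0.
  have [i xy] := x_cover y.
  have uVi := uV 0 i; rewrite !mxE in uVi; rewrite -[RHS]uVi.
  rewrite (big_nth set0) big_mkord; apply: eq_bigr => j _.
  rewrite AE -scalemxAl mxtraceZ mxE; congr (_ * _).
  have [_ _ iU] := dual_intertwinerP (fs _ (mem_nth set0 (ltn_ord j))).
  by apply/esym; apply: trace_twisted_conj xy.
apply/matrixP=> k j; rewrite ord1 mxE.
have js := mem_nth set0 (ltn_ord j).
have /eqP : A (nth set0 s j) = 0.
  by apply: (dual_coefs_independent us) sumA _ js => c /fs[].
rewrite AE scaler_eq0 => /orP[/eqP // | ].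
by rewrite (negPf (dual_intertwiner_neq0 (fs _ js))).
Qed.

(** The unit row vectors are the values of the indicators of the classes.  Such
    an indicator is a sum of irreducible coefficients, whose matrices
    intertwine; the nonzero ones belong to fixed points and are multiples of
    [dual_intertwiner], so each contributes a multiple of a row. *)
Lemma twisted_character_table_full s :
    (forall c, dual_fixed_points R phi c -> c \in s) ->
    (forall i j, twisted_conj phi (x i) (x j) -> i = j) ->
    (forall i, periodic phi (charfun (twisted_class phi (x i)))) ->
  row_full (twisted_character_table s).
Proof.
move=> sf x_inj per; rewrite -sub1mx; apply/row_subP => i.
have [t [A [ut dt fE]]] := periodic_dual_span R (per i).
have iA := twisted_coefs_intertwine ut dt _.
have -> : row i 1%:M = \sum_(c <- t) \row_k \tr (A c *m dual_rep c (x k)).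
  apply/matrixP=> r k; rewrite summxE !mxE.
  under eq_bigr do rewrite mxE.
  rewrite -fE; congr ((_ : bool)%:R); rewrite /charfun.
  apply/eqP/asboolP => [->|/x_inj //]; exact: twisted_conj_refl.
rewrite big_seq; apply: summx_sub => c ct.
have {iA} iAc : twisted_intertwiner c (A c).
  apply: iA => // y z yz; rewrite -!fE; congr ((_ : bool)%:R).
  rewrite /charfun; apply/asboolP/asboolP => /= xy.
    exact: twisted_conj_trans yz.
  by apply: twisted_conj_trans (twisted_conj_sym yz).
have [->|Ac0] := eqVneq (A c) 0.
  rewrite (_ : \row__ _ = 0) ?sub0mx //; apply/matrixP=> r k.
  by rewrite !mxE mul0mx mxtrace0.
have fc := intertwiner_dual_fixed (dt _ ct) iAc Ac0.
have [a ->] := twisted_intertwiner_scalar fc iAc.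
have cs : (index c s < size s)%N by rewrite index_mem sf.
rewrite (_ : \row__ _ = a *: row (Ordinal cs) (twisted_character_table s)).
  by rewrite scalemx_sub // row_sub.
apply/matrixP=> r k; rewrite !mxE /= nth_index ?sf //.
by rewrite -scalemxAl mxtraceZ.
Qed.

End Representatives.
End FixedPoints.

(** * The number of fixed points *)

Theorem theorem5p2 (R : realType) (G : groupType)
  (G_countable : countable [set: G]) (G_RP : RP_group G)
  (phi : {multiplicative G -> G}) (phi_bij : bijective phi)
  (phi_fin : finite_set (reidemeister_classes phi)) :
  reidemeister_classes phi #= dual_fixed_points R phi.
Proof.
have per := G_RP phi phi_bij phi_fin.
have [X XE] := (finite_fsetP).1 phi_fin.
have X_class (i : 'I_#|` X|) :
    exists y, twisted_class phi y = nth set0 (enum_fset X) i.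
  have : [set` X] (nth set0 (enum_fset X) i) by apply: mem_nth.
  by rewrite -XE => -[y _ yE]; exists y.
have [x xE] := choice X_class.
have x_cover y : exists i, twisted_conj phi (x i) y.
  have yX : twisted_class phi y \in X.
    have : reidemeister_classes phi (twisted_class phi y) by exists y.
    by rewrite XE.
  have iX : (index (twisted_class phi y) (enum_fset X) < #|` X|)%N.
    by rewrite index_mem.
  exists (Ordinal iX); apply/twisted_class_eqP.
  by rewrite xE /= nth_index.
have x_inj i j : twisted_conj phi (x i) (x j) -> i = j.
  move=> /twisted_class_eqP; rewrite !xE => /eqP.
  by rewrite nth_uniq ?fset_uniq // => /eqP/val_inj.
have size_le s : uniq s -> (forall c, c \in s -> dual_fixed_points R phi c) ->
    (size s <= #|` X|)%N.
  move=> us fs; have := twisted_character_table_free x_cover us fs.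
  by rewrite /row_free => /eqP <-; apply: rank_leq_col.
have S_fin : finite_set (dual_fixed_points R phi).
  apply: contrapT => /(infinite_set_fset #|` X|.+1)[B BS].
  rewrite leqNgt ltnS; apply/negP/negPn; apply: size_le; first exact: fset_uniq.
  by move=> c cB; apply: BS.
have [S SE] := (finite_fsetP).1 S_fin.
have cardSX : #|` S| = #|` X|.
  apply/eqP; rewrite eqn_leq size_le ?fset_uniq //=; last first.
    by move=> c cS; rewrite SE.
  have : row_full (twisted_character_table phi x (enum_fset S)).
    apply: twisted_character_table_full => // [c|i]; first by rewrite SE.
    by apply: per; exists (x i).
  by rewrite /row_full => /eqP <-; apply: rank_leq_row.
apply: (@card_eq_trans _ _ _ _ `I_#|` X|).
  by rewrite XE; apply/card_eq_fsetP.
by rewrite card_eq_sym SE; apply/card_eq_fsetP.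
Qed.
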